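(* Let $(U, A, B_1,\dots,B_{m/2})$ be an admissable ordered collection, where $A$ has order $m$ and $U\subset\mathbb{R}^n$. Suppose that $A$ is positive and $m > \frac{n}{2}$, and let $G(x,\xi)$ be the Green's function associated with $(U,A,B_1,\dots,B_{m/2})$. Then $$\int_U \int_U z(x)\, G(x,\xi)\, z(\xi) \, dx \, d\xi \geq 0$$ for all $z \in L^2(U)$.
   Context: All functions are real-valued, and $L^2(U)$, $H^m(U)$ denote the usual (real) Lebesgue and Sobolev spaces. Let $n$ be a positive integer and let $U$ be a bounded domain of $\mathbb{R}^n$ whose boundary $S$ consists of a finite number of smooth hypersurfaces. Let $A=A(x,\partial/\partial x)$ be a linear elliptic differential operator of (even) order $m$, and let $B_j=B_j(x,\partial/\partial x)$, $j=1,\dots,m/2$, be boundary differential operators such that: at every point $x$ of $S$ the normal direction is not characteristic for any $B_j$; and the order $m_j$ of $B_j$ is less than $m$, with $m_j\neq m_k$ for $j\ne k$. The domain of $A$ is $\mathcal{D}(A)=\{u\in H^m(U) : B_j(x,\partial/\partial x)u(x)=0 \text{ for } x\in S,\ j=1,\dots,m/2\}$. The ordered collection $(U,A,B_1,\dots,B_{m/2})$ is called admissable if $U$ is a bounded domain of $\mathbb{R}^n$ whose boundary $S$ consists of a finite number of smooth hypersurfaces, $A$ is a linear elliptic differential operator of (even) order $m$ with domain $\mathcal{D}(A)$, the $B_j$, $j=1,\dots,m/2$, are boundary differential operators of orders $m_j<m$, with $m_j\neq m_k$ for $j\neq k$, for none of which the normal direction is characteristic at any point of $S$, $A$ is a one-to-one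 mapping from $\mathcal{D}(A)$ onto $L^2(U)$, and $A^{-1}$ is self-adjoint in $L^2(U)$. The inverse $G=A^{-1}$ is called the Green's operator. It is a known standing fact that $G$ is represented by an integral operator of Hilbert–Schmidt type: $(Gf)(x)=\int_U G(x,\xi)f(\xi)\,d\xi$ for $f\in L^2(U)$, with $\int_U\int_U|G(x,\xi)|^2\,dx\,d\xi<\infty$; the kernel $G(x,\xi)$ is called the Green's function associated with the collection. It is also known that $G$ maps $L^2(U)$ continuously into $H^m(U)$, and hence, when $m>n/2$, continuously into $C^0(\bar U)$. A Green's operator is called positive if all of its eigenvalues are real and positive; $A$ is called positive if all of its eigenvalues (on $\mathcal{D}(A)$) are real and positive, equivalently if $G=A^{-1}$ is positive. *)

(* Defs.v *)
From HB Require Import structures.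
From mathcomp Require Import all_boot all_order all_algebra.
From mathcomp Require Import all_classical all_reals all_analysis.
From mathcomp Require Import measurable_realfun.

Set Implicit Arguments.
Unset Strict Implicit.
Unset Printing Implicit Defensive.

Import Order.TTheory GRing.Theory Num.Theory.
Import numFieldTopology.Exports numFieldNormedType.Exports.

Local Open Scope classical_set_scope.
Local Open Scope ring_scope.

(* Points of R^n are row vectors 'rV[R]_n, with the Borel
   sigma-algebra generated by the open sets. A class of L^2 is represented by
   its Borel measurable members, and equalities of L^2 functions hold almost
   everywhere. *)

Fact rV_display : measure_display. Proof. exact: default_measure_display. Qed.

Section borel.
Context {R : realType} {n : nat}.
Let B := [set A : set 'rV[R]_n | open A].

Let rV_setC (A : set 'rV[R]_n) : <<s B >> A -> <<s B >> (~` A).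
Proof. by move=> sA; rewrite -setTD; exact: sigma_algebraCD. Qed.

HB.instance Definition _ := @isMeasurable.Build rV_display 'rV[R]_n <<s B >>
  (@sigma_algebra0 _ setT B) rV_setC (@sigma_algebra_bigcup _ setT B).

Lemma open_measurable_rV (A : set 'rV[R]_n) : open A -> measurable A.
Proof. by move=> oA; exact: sub_sigma_algebra. Qed.

End borel.

Section cons.
Context {R : realType} {n : nat}.

Definition cons_rV (p : R * 'rV[R]_n) : 'rV[R]_n.+1 := row_mx (p.1%:M : 'rV_1) p.2.
Definition uncons_rV (v : 'rV[R]_n.+1) : R * 'rV[R]_n :=
  (v ord0 ord0, rsubmx (v : 'rV_(1 + n))).

Lemma cons_rVK : cancel cons_rV uncons_rV.
Proof.
move=> [a v]; rewrite /uncons_rV /cons_rV /= row_mxKr; congr pair.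
by rewrite mxE; case: splitP => // j _; rewrite mxE !ord1 eqxx.
Qed.

Lemma uncons_rVK : cancel uncons_rV cons_rV.
Proof.
move=> v; rewrite /uncons_rV /cons_rV /=.
have -> : (v ord0 ord0)%:M = lsubmx (v : 'rV_(1 + n)) :> 'rV_1.
  by apply/rowP => i; rewrite !mxE !ord1/=; congr (v _ _); exact/val_inj.
exact: (@hsubmxK R 1 1 n v).
Qed.

Lemma measurable_uncons : measurable_fun setT uncons_rV.
Proof.
apply/measurable_fun_pair => /=.
  apply: (measurability _ (RGenOpens.measurableE R)) => _ [_ [a [b ->] <-]].
  rewrite setTI; apply: open_measurable_rV.
  apply: open_comp; last exact: interval_open.
  by move=> x _; exact: coord_continuous.
apply: (measurability [set A : set 'rV[R]_n | open A] erefl) => _ [V oV <-]; rewrite setTI.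
apply: open_measurable_rV; apply: open_comp => // x _.
exact: continuous_rsubmx.
Qed.

Lemma measurable_cons : measurable_fun setT cons_rV.
Proof.
apply: (measurability [set A : set 'rV[R]_n.+1 | open A] erefl) => _ [V oV <-]; rewrite setTI.
pose bx (z : 'rV[rat]_n.+1 * nat) : set (R * 'rV[R]_n) :=
  ball (ratr (z.1 ord0 ord0) : R) (z.2.+1%:R^-1) `*`
  ball (rsubmx (map_mx ratr z.1 : 'rV[R]_(1 + n))) (z.2.+1%:R^-1).
pose F k := if unpickle k is Some z then
  if `[< bx z `<=` cons_rV @^-1` V >] then bx z else set0 else set0.
have -> : cons_rV @^-1` V = \bigcup_k F k.
  apply/seteqP; split => [[a v] /= Vav|p [k _]]; last first.
    by rewrite /F; case: unpickle => // z; case: ifPn => // /asboolP; apply.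
  have : nbhs (cons_rV (a, v)) V by exact: open_nbhs_nbhs.
  move=> /nbhs_ballP[e /= e0 eV].
  have [k ke] : exists k : nat, k.+1%:R^-1 < e / 2.
    have e2 : 0 < e / 2 by rewrite divr_gt0.
    have [k _ kP] := near_infty_natSinv_lt (PosNum e2).
    by exists k; exact: (kP k (leqnn k)).
  pose d : R := k.+1%:R^-1.
  have d0 : 0 < d by rewrite /d invr_gt0.
  have app (r : R) : {s : rat | `|ratr s - r| < d}.
    apply: cid; have /rat_in_itvoo[s /itvP sP] : r < r + d by rewrite ltrDl.
    exists s; rewrite ltr_distl; apply/andP; split; last by rewrite sP.
    by rewrite (lt_trans _ (_ : r < _)) ?sP// ltrBlDr ltrDl.
  pose w := cons_rV (a, v).
  pose z : 'rV[rat]_n.+1 := \row_i sval (app (w ord0 i)).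
  have wv : (a, v) = uncons_rV w by rewrite cons_rVK.
  have zw i : `|ratr (z ord0 i) - w ord0 i| < d.
    by rewrite mxE; exact: (svalP (app _)).
  exists (pickle (z, k)) => //; rewrite /F pickleK.
  have -> : `[< bx (z, k) `<=` cons_rV @^-1` V >].
    apply/asboolP => -[b u] [/= zb [_ zu]]; apply: eV; split => // i j.
    rewrite ord1 {i}; apply: (@ball_splitr R R (ratr (z ord0 j))).
      by apply: (@le_ball _ _ _ d (e / 2)); [exact: ltW|exact: zw].
    apply: (@le_ball _ _ _ d (e / 2)); first exact: ltW.
    have -> : cons_rV (b, u) ord0 j = if fintype.split (j : 'I_(1 + n)) is inr j' then u ord0 j' else b.
      rewrite /cons_rV mxE; case: fintype.split => // j'.
      by rewrite mxE !ord1 eqxx.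
    case: splitP => j' jE.
      suff -> : j = ord0 by [].
      by apply/val_inj; rewrite /= jE ord1.
    have := zu ord0 j'; rewrite !mxE.
    by suff -> : rshift 1 j' = j by []; exact/val_inj.
  rewrite wv; split => /=; first exact: zw.
  clearbody z w; split => // i j; rewrite !mxE ord1; exact: zw.
apply: bigcupT_measurable => k; rewrite /F; case: unpickle => // z.
case: ifPn => // _; apply: measurableX.
  exact: measurable_ball.
by apply: open_measurable_rV; exact: ball_open.
Qed.
End cons.

Section lebesgue_succ.
Local Open Scope ereal_scope.
Context {R : realType} {n : nat}.
Variable mu : {sigma_finite_measure set 'rV[R]_n -> \bar R}.

Definition leb_succ (A : set 'rV[R]_n.+1) : \bar R :=
  (lebesgue_measure \x mu) (cons_rV @^-1` A).

Let leb_succ0 : leb_succ set0 = 0.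
Proof. by rewrite /leb_succ preimage_set0 measure0. Qed.

Let leb_succ_ge0 A : 0 <= leb_succ A.
Proof. exact: measure_ge0. Qed.

Let leb_succ_sigma_additive : semi_sigma_additive leb_succ.
Proof.
have mc (A : set 'rV[R]_n.+1) : measurable A -> measurable (cons_rV @^-1` A).
  by move=> mA; rewrite -[X in measurable X]setTI; exact: measurable_cons.
move=> F mF tF mUF; rewrite /leb_succ preimage_bigcup.
apply: measure_semi_sigma_additive.
- by move=> k; exact: mc.
- apply/trivIsetP => /= i j _ _ ij; rewrite -preimage_setI.
  by move/trivIsetP : tF => /(_ _ _ _ _ ij) ->//; rewrite preimage_set0.
- by rewrite -preimage_bigcup; exact: mc.
Qed.

HB.instance Definition _ := isMeasure.Build _ _ _ leb_succ
  leb_succ0 leb_succ_ge0 leb_succ_sigma_additive.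

Let leb_succ_sigma_finite : sigma_finite setT leb_succ.
Proof.
have /sigma_finiteP[F [TF ndF Foo]] := sigma_finiteT (@lebesgue_measure R).
have /sigma_finiteP[G [TG ndG Goo]] := sigma_finiteT mu.
exists (fun k => uncons_rV @^-1` (F k `*` G k)).
  rewrite -preimage_bigcup (_ : \bigcup_k _ = setT) ?preimage_setT//.
  apply/seteqP; split => // -[x y] _.
  have [k _ Fx] : (\bigcup_k F k) x by rewrite -TF.
  have [l _ Gy] : (\bigcup_l G l) y by rewrite -TG.
  exists (maxn k l) => //; split => /=.
  - by move: x Fx; exact/subsetPset/ndF/leq_maxl.
  - by move: y Gy; exact/subsetPset/ndG/leq_maxr.
move=> k; have [mF Fk] := Foo k; have [mG Gk] := Goo k; split.
  by rewrite -[X in measurable X]setTI; apply: measurable_uncons => //;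
     exact: measurableX.
rewrite /leb_succ (_ : cons_rV @^-1` _ = F k `*` G k).
  by rewrite product_measure1E// lte_mul_pinfty// ge0_fin_numE.
by apply/seteqP; split => p; rewrite /preimage /mkset cons_rVK.
Qed.

HB.instance Definition _ := Measure_isSigmaFinite.Build _ _ _ leb_succ
  leb_succ_sigma_finite.

End lebesgue_succ.

(* The n-dimensional Lebesgue measure on Borel sets, as the iterated product of
   the Lebesgue measure of the line, transported along R * R^n' ~ R^(n'+1). *)
Fixpoint leb {R : realType} (n : nat) :
    {sigma_finite_measure set 'rV[R]_n -> \bar R} :=
  match n with
  | 0 => dirac (0 : 'rV[R]_0)
  | n'.+1 => leb_succ (leb n')
  end.

Section hausdorff.
Local Open Scope ereal_scope.
Context {R : realType} {n : nat}.
Implicit Types (k : nat) (d : R) (A X : set 'rV[R]_n).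

Definition enorm (x : 'rV[R]_n) : R := Num.sqrt (\sum_i x ord0 i ^+ 2).

Definition ediam A : \bar R :=
  ereal_sup [set (enorm (p.1 - p.2))%:E | p in A `*` A].

(* The empty set has weight 0 also when k = 0, whereas a nonempty set of
   diameter 0 has weight 0 ^+ 0 = 1, so that the 0-dimensional measure counts. *)
Definition hausdorff_gauge k d A : \bar R :=
  if A == set0 then 0
  else if ediam A <= d%:E then (fine (ediam A) ^+ k)%:E else +oo.

(* mu_ext is the infimum over countable Borel covers; restricting to Borel covers
   is harmless as a set and its closure have the same diameter. This Hausdorff
   measure is not normalised: on smooth hypersurfaces it is a constant multiple
   of the surface measure, which changes neither L^2(S) nor its null sets. *)
Definition hausdorff k X : \bar R :=
  ereal_sup [set mu_ext (hausdorff_gauge k d) X | d in [set d | (0 < d)%R]].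

Lemma hausdorff_gauge0 k d : hausdorff_gauge k d set0 = 0.
Proof. by rewrite /hausdorff_gauge eqxx. Qed.

Lemma hausdorff_gauge_ge0 k d A : 0 <= hausdorff_gauge k d A.
Proof.
rewrite /hausdorff_gauge; case: ifPn => // /set0P[x Ax].
case: ifPn => // _; rewrite lee_fin exprn_ge0// fine_ge0//.
apply: ereal_sup_ubound; exists (x, x) => //=.
by rewrite /enorm subrr big1 ?sqrtr0// => i _; rewrite mxE expr0n.
Qed.

Section outer.
Variable k : nat.

Let hausdorff0 : hausdorff k set0 = 0.
Proof.
apply/eqP; rewrite eq_le; apply/andP; split.
  apply: ge_ereal_sup => _ [d _ <-]; rewrite mu_ext0//.
  - exact: hausdorff_gauge0.
  - exact: hausdorff_gauge_ge0.
apply: ereal_sup_ubound; exists 1%R => //=; rewrite mu_ext0//.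
- exact: hausdorff_gauge0.
- exact: hausdorff_gauge_ge0.
Qed.

Let hausdorff_ge0 X : 0 <= hausdorff k X.
Proof.
apply: (@le_trans _ _ (mu_ext (hausdorff_gauge k 1) X)).
  by apply: mu_ext_ge0 => A; exact: hausdorff_gauge_ge0.
by apply: ereal_sup_ubound; exists 1%R => /=.
Qed.

Let le_hausdorff : {homo hausdorff k : A B / A `<=` B >-> A <= B}.
Proof.
move=> A B AB; apply: ge_ereal_sup => _ [d d0 <-].
apply: (le_trans (le_mu_ext _ AB)).
by apply: ereal_sup_ubound; exists d.
Qed.

Let hausdorff_sigma_subadditive : sigma_subadditive (hausdorff k).
Proof.
move=> F; apply: ge_ereal_sup => _ [d d0 <-].
apply: (le_trans (mu_ext_sigma_subadditive (hausdorff_gauge_ge0 k d) F)).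
apply: lee_nneseries => [i _ _|i _].
  by apply: mu_ext_ge0 => A; exact: hausdorff_gauge_ge0.
by apply: ereal_sup_ubound; exists d.
Qed.

HB.instance Definition _ := isOuterMeasure.Build R 'rV[R]_n (hausdorff k)
  hausdorff0 hausdorff_ge0 le_hausdorff hausdorff_sigma_subadditive.

End outer.
End hausdorff.

Section surface.
Context (R : realType) (n : nat).

Definition surface_outer : {outer_measure set 'rV[R]_n -> \bar R} :=
  @hausdorff R n n.-1.

Definition surface_type := caratheodory_type surface_outer.

HB.instance Definition _ := Measurable.on surface_type.

Definition surface_measure : {measure set surface_type -> \bar R} :=
  surface_outer : {measure set (caratheodory_type surface_outer) -> \bar R}.

End surface.

Section multi_index.
Context {n m : nat}.

(* Multi-indices of length n and order at most m. *)
Definition mindex := {a : {ffun 'I_n -> 'I_m.+1} | (\sum_i a i <= m)%N}.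

Definition morder (a : mindex) : nat := (\sum_i val a i)%N.

End multi_index.
Arguments mindex : clear implicits.

Section calculus.
Context {R : realType} {n : nat}.
Local Notation E := 'rV[R]_n.

Definition partial (i : 'I_n) (f : E -> R) : E -> R :=
  fun x => 'D_(delta_mx ord0 i) f x.

Definition gradient (f : E -> R) (x : E) : E := \row_i partial i f x.

(* Only meaningful for smooth f, for which the order of differentiation does not
   matter. *)
Definition mderive m (a : mindex n m) (f : E -> R) : E -> R :=
  foldr (fun i g => iter (val a i) (partial i) g) f (enum 'I_n).

(* C^oo on V: all iterated partial derivatives exist and are continuous at the
   points of V (V is meant to be open). *)
Definition smooth_on (V : set E) (f : E -> R) : Prop :=
  forall (s : seq 'I_n) (x : E), V x ->
    let g := foldr partial f s in
    {for x, continuous g} /\ forall i, derivable g x (delta_mx ord0 i).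

Definition test_function (U : set E) (phi : E -> R) : Prop :=
  smooth_on setT phi /\
  exists K : set E, [/\ compact K, K `<=` U & forall x, ~ K x -> phi x = 0].

Definition boundary (U : set E) : set E := closure U `&` closure (~` U).

(* g is a local defining function of the hypersurface T near its point x. *)
Definition defining_function (T : set E) (x : E) (g : E -> R) : Prop :=
  exists V : set E, [/\ open V, V x, smooth_on V g, gradient g x != 0
    & forall y, V y -> (T y <-> g y = 0)].

(* Embedded smooth hypersurface, closed as a subset of R^n. *)
Definition smooth_hypersurface (T : set E) : Prop :=
  closed T /\ forall x, T x -> exists g, defining_function T x g.

Definition smooth_boundary (U : set E) : Prop :=
  exists (N : nat) (T : 'I_N -> set E),
    (forall i, smooth_hypersurface (T i)) /\
    boundary U = [set x | exists i, T i x].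

(* nu is a nonzero normal vector at x to a smooth hypersurface contained in S. *)
Definition normal (S : set E) (x nu : E) : Prop :=
  exists T g, [/\ smooth_hypersurface T, T `<=` S, T x,
    defining_function T x g & nu = gradient g x].

End calculus.

Section function_spaces.
Context {R : realType} {n : nat}.
Local Notation E := 'rV[R]_n.
Implicit Types (U : set E) (u v f g : E -> R).

Definition ae_eq_on U f g : Prop :=
  {ae leb n, forall x, U x -> f x = g x}.

Definition L2 U f : Prop :=
  measurable_fun U f /\ (\int[leb n]_(x in U) (f x ^+ 2)%:E < +oo)%E.

Definition inner U f g : R := \int[leb n]_(x in U) (f x * g x).

Definition L2_cvg U (f_ : nat -> E -> R) f : Prop :=
  (\int[leb n]_(x in U) ((f_ k x - f x) ^+ 2)%:E)%E @[k --> \oo] --> 0%E.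

Definition L2_surface (S : set E) g : Prop :=
  measurable_fun (S : set (surface_type R n)) (g : surface_type R n -> R) /\
  (\int[surface_measure R n]_(x in S) (g x ^+ 2)%:E < +oo)%E.

Definition L2_surface_cvg (S : set E) (g_ : nat -> E -> R) g : Prop :=
  (\int[surface_measure R n]_(x in S) ((g_ k x - g x) ^+ 2)%:E)%E @[k --> \oo]
    --> 0%E.

(* v is the weak derivative of index a of u in U. *)
Definition weak_derivative U m (a : mindex n m) u v : Prop :=
  forall phi, test_function U phi ->
    inner U u (mderive a phi) = (-1) ^+ morder a * inner U v phi.

(* w is the family of all the weak derivatives of order <= m of u, and all of
   them are in L^2(U). *)
Definition sobolev_jet U m u (w : mindex n m -> E -> R) : Prop :=
  L2 U u /\ forall a, L2 U (w a) /\ weak_derivative U a u (w a).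

Definition sobolev U m u : Prop := exists w, sobolev_jet (m := m) U u w.

(* g in L^2(S) is the trace on S of v in H^1(U): the trace operator is the
   continuous extension to H^1(U) of the restriction to S of the functions that
   are smooth up to the boundary. *)
Definition is_trace U v g : Prop :=
  L2_surface (boundary U) g /\
  exists (w : mindex n 1 -> E -> R) (phi : nat -> E -> R),
    [/\ sobolev_jet U v w,
        forall k, smooth_on setT (phi k),
        forall a, L2_cvg U (fun k => mderive a (phi k)) (w a)
      & L2_surface_cvg (boundary U) phi g].

(* Linear differential operators of order at most m, given by their coefficients:
   the operator is the sum over a of P a x times the derivative of index a. *)
Definition diffop m := mindex n m -> E -> R.

Definition apply_jet m (P : diffop m) (w : mindex n m -> E -> R) : E -> R :=
  fun x => \sum_a P a x * w a x.

Definition principal_symbol m (P : diffop m) (x xi : E) : R :=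
  \sum_(a | morder a == m) P a x * \prod_i xi ord0 i ^+ val a i.

Definition acts U m (A : diffop m) u f : Prop :=
  exists w, sobolev_jet U u w /\ ae_eq_on U f (apply_jet A w).

(* B u = 0 on S, the derivatives in B being taken on S in the sense of traces
   (they are in H^1(U) when u is in H^m(U) with m larger than the order of B). *)
Definition vanishes_on_boundary U k (B : diffop k) u : Prop :=
  exists w t : mindex n k -> E -> R,
    [/\ sobolev_jet U u w,
        forall a, is_trace U (w a) (t a)
      & {ae surface_measure R n, forall x, boundary U x -> apply_jet B t x = 0}].

End function_spaces.

Arguments diffop : clear implicits.

(* An ordered collection (U, A, B_1, .., B_(m/2)); indices j start at 0. *)
Record collection (R : realType) (n : nat) := Collection {
  region : set 'rV[R]_n;
  op_order : nat;
  operator : diffop R n op_order;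
  boundary_order : 'I_(op_order./2) -> nat;
  boundary_op : forall j, diffop R n (boundary_order j) }.

Arguments operator {R n} c.
Arguments boundary_order {R n} c j.
Arguments boundary_op {R n} c j.

Section collection_theory.
Context {R : realType} {n : nat}.
Local Notation E := 'rV[R]_n.
Variable c : collection R n.
Local Notation U := (region c).
Local Notation A := (operator c).

Definition op_domain (u : E -> R) : Prop :=
  sobolev U (op_order c) u /\ forall j, vanishes_on_boundary U (boundary_op c j) u.

(* Graph of the Green's operator, the inverse of A on its domain. *)
Definition green_operator (f u : E -> R) : Prop :=
  [/\ L2 U f, op_domain u & acts U A u f].

(* T, the graph of a densely defined operator of L^2(U), is the graph of its
   adjoint. *)
Definition self_adjoint (T : (E -> R) -> (E -> R) -> Prop) : Prop :=
  forall g h, L2 U g -> L2 U h ->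
    (T g h <-> forall f u, T f u -> inner U u g = inner U f h).

(* The coefficients are only asked to be continuous, up to the boundary for A and
   on the boundary for the B_j. Noncharacteristic forces B_j to have order exactly
   boundary_order c j, as elliptic does for A. *)
Record admissible : Prop := Admissible {
  region_open : open U;
  region_connected : connected U;
  region_neq0 : U !=set0;
  region_bounded : bounded_set U;
  region_boundary : smooth_boundary U;
  order_even : ~~ odd (op_order c);
  operator_continuous : forall a, {within closure U, continuous (A a)};
  operator_elliptic : forall x xi, closure U x -> xi != 0 ->
    principal_symbol A x xi != 0;
  boundary_order_lt : forall j, (boundary_order c j < op_order c)%N;
  boundary_order_inj : injective (boundary_order c);
  boundary_op_continuous : forall j a,
    {within boundary U, continuous (boundary_op c j a)};
  boundary_op_noncharacteristic : forall j x nu, boundary U x ->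
    normal (boundary U) x nu -> principal_symbol (boundary_op c j) x nu != 0;
  operator_into : forall u, op_domain u -> exists f, L2 U f /\ acts U A u f;
  operator_onto : forall f, L2 U f -> exists u, op_domain u /\ acts U A u f;
  operator_inj : forall f u v, op_domain u -> op_domain v ->
    acts U A u f -> acts U A v f -> ae_eq_on U u v;
  green_self_adjoint : self_adjoint green_operator }.

Definition eigenvalue_on_domain (l : R) : Prop :=
  exists u, [/\ op_domain u, ~ ae_eq_on U u (cst 0) & acts U A u (fun x => l * u x)].

Definition positive_operator : Prop :=
  forall l, eigenvalue_on_domain l -> 0 < l.

Definition green_function (G : E -> E -> R) : Prop :=
  [/\ measurable_fun (U `*` U) (fun p : E * E => G p.1 p.2),
      (\int[leb n]_(xi in U) \int[leb n]_(x in U) (G x xi ^+ 2)%:E < +oo)%E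
    & forall f u, green_operator f u ->
        ae_eq_on U u (fun x => \int[leb n]_(xi in U) (G x xi * f xi))].

End collection_theory.

(* Main.v *)
From HB Require Import structures.
Require Import Defs.
From mathcomp Require Import all_boot all_order all_algebra.
From mathcomp Require Import all_classical all_reals all_analysis.
From mathcomp Require Import measurable_realfun ring lra.

(* The operator K with kernel G is symmetric, and every eigenvector of K for a
   negative eigenvalue l is an eigenvector of A for 1 / l, so that K has no
   negative eigenvalue; it remains to see that <K f, f> >= 0.

   Otherwise let l < 0 be the infimum of <K f, f> on the unit sphere, and let
   P = 1 - (K - l) / M with M so large that 0 <= P <= 1. Then <P^k h, h> is
   nonincreasing in k and P^k h is a Cauchy sequence; as its limit satisfies
   K u = l u, it vanishes. In particular P^k (r x) tends to 0 for almost every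
   row r x = G(x, .). Take unit vectors f_k such that <K f_k, f_k> is so close to
   l that <K P^k f_k, f_k> <= l / 2. The functions u_k = K P^k f_k satisfy
   |u_k(x)| = |<P^k (r x), f_k>| <= ||P^k (r x)|| <= ||r x||, and x |-> ||r x|| is
   square integrable, so u_k tends to 0 in L^2 by dominated convergence, although
   <u_k, f_k> <= l / 2 < 0. *)

Set Implicit Arguments.
Unset Strict Implicit.
Unset Printing Implicit Defensive.

Import Order.TTheory GRing.Theory Num.Theory.
Import numFieldTopology.Exports numFieldNormedType.Exports.

Local Open Scope classical_set_scope.
Local Open Scope ring_scope.

(** * Positive contractions *)

Section semi_inner_product.
Context {R : realType} {V : lmodType R} (ip : V -> V -> R).

(** Definiteness fails in the intended model: the elements of [LfunType] are functions rather than
    classes, so a function that vanishes almost everywhere pairs to 0 with itself without being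
    0. *)
Definition semi_inner_product := [/\ forall f g, ip f g = ip g f,
  forall f g h, ip (f + g) h = ip f h + ip g h,
  forall a f g, ip (a *: f) g = a * ip f g & forall f, 0 <= ip f f].

Hypothesis ipP : semi_inner_product.

Lemma ipC f g : ip f g = ip g f. Proof. by case: ipP. Qed.
Lemma ipDl f g h : ip (f + g) h = ip f h + ip g h. Proof. by case: ipP. Qed.
Lemma ipZl a f g : ip (a *: f) g = a * ip f g. Proof. by case: ipP. Qed.
Lemma ip_ge0 f : 0 <= ip f f. Proof. by case: ipP. Qed.
Lemma ipDr f g h : ip h (f + g) = ip h f + ip h g.
Proof. by rewrite ipC ipDl !(ipC h). Qed.
Lemma ipZr a f g : ip g (a *: f) = a * ip g f.
Proof. by rewrite ipC ipZl ipC. Qed.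
Lemma ipNl f g : ip (- f) g = - ip f g.
Proof. by rewrite -scaleN1r ipZl mulN1r. Qed.
Lemma ipNr f g : ip f (- g) = - ip f g.
Proof. by rewrite ipC ipNl ipC. Qed.

Lemma ip_cauchy_schwarz f g : ip f g ^+ 2 <= ip f f * ip g g.
Proof.
have := ip_ge0 g; rewrite le_eqVlt => /orP[/eqP g0|g0].
  rewrite -g0 mulr0 real_leNgt ?num_real//; apply/negP => fg0.
  have fgn0 : ip f g != 0 by move: fg0; rewrite exprn_even_gt0.
  (* When <g, g> = 0, <f + t g, f + t g> is affine in t; this t gives it the value -1. *)
  pose t := - (ip f f + 1) / (2 * ip f g).
  have := ip_ge0 (f + t *: g).
  rewrite !(ipDl, ipDr, ipZl, ipZr) -g0 (ipC g f).
  have : t * ip f g = - (ip f f + 1) / 2 by rewrite /t; field.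
  by lra.
(* The square of this vector is <g, g> (<f, f> <g, g> - <f, g>^2). *)
have := ip_ge0 (ip g g *: f - ip f g *: g).
rewrite !(ipDl, ipDr, ipZl, ipZr, ipNl, ipNr) (ipC g f) => h.
by rewrite -(ler_pM2l g0); lra.
Qed.

Lemma ip_sqrD_le f g : ip (f + g) (f + g) <= 2 * (ip f f + ip g g).
Proof.
have := ip_ge0 (f - g); rewrite !(ipDl, ipDr, ipNl, ipNr) (ipC g f); lra.
Qed.

(** * Powers of a symmetric operator P with 0 <= P <= 1 *)

Section contraction.
Context (P : V -> V).
Hypothesis PB : {morph P : f g / f - g}.
Hypothesis Psym : forall f g, ip (P f) g = ip f (P g).
Hypothesis P_ge0 : forall f, 0 <= ip (P f) f.
Hypothesis P_le1 : forall f, ip (P f) f <= ip f f.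

Local Notation a k f := (ip (iter k P f) f).

Lemma ip_iter i j f g : ip (iter i P f) (iter j P g) = ip (iter (i + j) P f) g.
Proof. by elim: j i => [|j IH] i; rewrite ?addn0//= -Psym -iterS IH addSnnS. Qed.

(** P (1 - P)^2 >= 0 and P^3 <= P^2, the latter being P <= 1 tested on P f, add up to P^2 <= P. *)
Lemma ip_sqr_le f : ip (P f) (P f) <= ip (P f) f.
Proof.
have := P_ge0 (f - P f); have := P_le1 (P f).
by rewrite !PB !(ipDl, ipDr, ipNl, ipNr) (Psym (P f) f); lra.
Qed.

(* Moving half of the iterations to the other side by symmetry leaves only the
   positivity of 1 and of P to use. *)
Lemma iter_split k f : exists g,
  (forall i, a (i + k) f = ip (iter i P g) g) \/
  (forall i, a (i + k) f = ip (iter i.+1 P g) g).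
Proof.
have E i j : ip (iter (i + (j + j)) P f) f = ip (iter i P (iter j P f)) (iter j P f).
  by rewrite -iterD ip_iter addnA.
exists (iter k./2 P f); case: (boolP (odd k)) => ok; [right|left] => i.
  by rewrite -[in LHS](odd_double_half k) ok -addnn addnA addn1 E.
by rewrite -[in LHS](odd_double_half k) (negbTE ok) -addnn add0n E.
Qed.

Lemma iter_ge0 k f : 0 <= a k f.
Proof.
have [g [/(_ 0%N)|/(_ 0%N)]] := iter_split k f; rewrite add0n => ->.
  exact: ip_ge0.
exact: P_ge0.
Qed.

Lemma iter_nincr k f : a k.+1 f <= a k f.
Proof.
have [g [E|E]] := iter_split k f; have := E 0%N; have := E 1%N;
  rewrite add1n add0n => -> ->/=; first exact: P_le1.
by rewrite Psym ip_sqr_le.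
Qed.

(** The second difference of <P^k f, f> is <P^k (1 - P)^2 f, f>. After splitting, it is the square
    of g - P g for even k, and the form of P at g - P g for odd k. *)
Lemma iter_convex k f : a k.+1 f - a k.+2 f <= a k f - a k.+1 f.
Proof.
have [g [E|E]] := iter_split k f; have := E 0%N; have := E 1%N; have := E 2%N;
  rewrite add2n add1n add0n => -> -> ->/=.
  have := ip_ge0 (g - P g); rewrite !(ipDl, ipDr, ipNl, ipNr).
  by rewrite (Psym (P g) g) (ipC g (P g)); lra.
have := P_ge0 (g - P g); rewrite PB !(ipDl, ipDr, ipNl, ipNr).
by rewrite (Psym (P (P g)) g) (Psym (P g) g); lra.
Qed.

Lemma iter_diff_le k f : a k f - a k.+1 f <= a 0%N f - a 1%N f.
Proof. elim: k => // k; apply: le_trans; exact: iter_convex. Qed.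

Lemma iter_lower k f : a 0%N f - k%:R * (a 0%N f - a 1%N f) <= a k f.
Proof.
elim: k => [|k IH]; first by rewrite mul0r subr0.
rewrite -natr1 mulrDl mul1r; have := iter_diff_le k f; lra.
Qed.

(* The squared distance is a (2i) - 2 a (i+j) + a (2j), and [a ^~ f] converges. *)
Lemma iter_cauchy f e : 0 < e ->
  \forall N \near \oo, forall i j, (N <= i)%N -> (N <= j)%N ->
  ip (iter i P f - iter j P f) (iter i P f - iter j P f) <= e.
Proof.
move=> e0; have : cvgn (fun k => a k f).
  apply: nonincreasing_is_cvgn.
    by apply/nonincreasing_seqP => k; exact: iter_nincr.
  by exists 0 => _ [k _ <-]; exact: iter_ge0.
(* The weights 1, -2, 1 cancel the limit, and the errors add up to (1 + 2 + 1) e / 4 = e. *)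
move=> /cvgrPdist_le/(_ (e / 4)) [|N _ HN]; first lra.
exists N => // M /= NM i j Mi Mj.
have H k : (M <= k)%N -> `|limn (fun k => a k f) - a k f| <= e / 4.
  by move=> Mk; apply: HN => /=; exact: leq_trans Mk.
rewrite !(ipDl, ipDr, ipNl, ipNr) !ip_iter (addnC j i).
have := H (i + i)%N (leq_trans Mi (leq_addr _ _)).
have := H (i + j)%N (leq_trans Mi (leq_addr _ _)).
have := H (j + j)%N (leq_trans Mj (leq_addr _ _)).
by rewrite !ler_norml; lra.
Qed.

End contraction.

(** * Symmetric operators whose quadratic form has a negative infimum l on the unit sphere *)

Section symmetric.
Context (K : {linear V -> V}) (C : R).
Hypothesis Ksym : forall f g, ip (K f) g = ip f (K g).
Hypothesis C_ge0 : 0 <= C.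
Hypothesis Kbnd : forall f, ip (K f) (K f) <= C * ip f f.
Hypothesis Kcvg : forall g : nat -> V,
  (forall e, 0 < e -> \forall N \near \oo, forall i j, (N <= i)%N -> (N <= j)%N ->
    ip (g i - g j) (g i - g j) <= e) ->
  exists u, forall e, 0 < e ->
    \forall k \near \oo, ip (u - K (g k)) (u - K (g k)) <= e.
Context (l : R).
Hypothesis l_lt0 : l < 0.
Hypothesis l_le : forall f, l * ip f f <= ip (K f) f.
Hypothesis l_inf : forall e, 0 < e -> exists f, ip f f = 1 /\ ip (K f) f <= l + e.

(** As quadratic forms l <= K <= C + 1, so (K - l) / M lies between 0 and 1. *)
Let M := C + 1 - l.
Let M_gt0 : 0 < M. Proof. by rewrite /M; have := C_ge0; have := l_lt0; lra. Qed.

(* 1 - (K - l) / M *)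
Definition shifted f := (1 + M^-1 * l) *: f - M^-1 *: K f.
Local Notation P := shifted.

(** [Kbnd] bounds the squared norm, so Cauchy-Schwarz gives <K f, f>^2 <= C <f, f>^2; since C <= (C
    + 1)^2, the constant C + 1 avoids a square root. *)
Lemma ip_op_le f : ip (K f) f <= (C + 1) * ip f f.
Proof.
have := ip_cauchy_schwarz (K f) f; have := Kbnd f; have := ip_ge0 f.
move=> f0 Kf fg; rewrite real_leNgt ?num_real//; apply/negP => h.
have : ((C + 1) * ip f f) ^+ 2 < ip (K f) f ^+ 2.
  rewrite ltr_pXn2r// nnegrE ?mulr_ge0//; first by have := C_ge0; lra.
  by apply: le_trans (ltW h); rewrite mulr_ge0//; have := C_ge0; lra.
have : ip (K f) (K f) * ip f f <= C * ip f f * ip f f by rewrite ler_wpM2r.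
have : 0 <= ip f f * ip f f * (C ^+ 2 + C + 1).
  by rewrite !mulr_ge0//; have := C_ge0; nra.
by move=> *; nra.
Qed.

Lemma shiftedB : {morph P : f g / f - g}.
Proof.
move=> f g; rewrite /P (raddfB K) !scalerBr.
by rewrite !opprD !opprK addrACA.
Qed.

Lemma shiftedE f : K f - l *: f = M *: (f - P f).
Proof.
rewrite /P scalerDl scale1r !opprD opprK !addrA subrr add0r scalerDr scalerN.
by rewrite !scalerA mulrA divff ?gt_eqF// mul1r scale1r addrC.
Qed.

Lemma ip_shifted f g : ip (P f) g = ip f g - M^-1 * (ip (K f) g - l * ip f g).
Proof. by rewrite /P !(ipDl, ipNl, ipZl); ring. Qed.

Lemma shifted_sym f g : ip (P f) g = ip f (P g).
Proof. by rewrite (ipC f) !ip_shifted Ksym (ipC g f) (ipC (K g)). Qed.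

Lemma shifted_ge0 f : 0 <= ip (P f) f.
Proof.
rewrite ip_shifted -(pmulr_rge0 _ M_gt0) mulrBr mulrA divff ?gt_eqF// mul1r.
by have := ip_op_le f; rewrite /M; lra.
Qed.

Lemma shifted_le1 f : ip (P f) f <= ip f f.
Proof.
rewrite ip_shifted gerBl mulr_ge0 ?invr_ge0 ?(ltW M_gt0)//.
by have := l_le f; lra.
Qed.

(* By convexity the decrements of <P^i f, f> are at most <(K - l) f, f> / M. *)
Lemma shifted_near_min k :
  exists f, ip f f = 1 /\ ip (K (iter k P f)) f <= l / 2.
Proof.
have kl : 0 < k%:R * - l / M + 1.
  by rewrite ltr_wpDl// divr_ge0 ?mulr_ge0// ?oppr_ge0 ltW.
(* Let b = <f, f> - <P f, f>, so that M b = <K f, f> - l. As K = l + M (1 - P), the two bounds on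
   the iterates give <K P^k f, f> <= l + M b (k (-l) / M + 1), and this tolerance brings the right
   side down to l / 2. *)
have [|f [f1 fe]] := @l_inf (- l / 2 / (k%:R * - l / M + 1)).
  by rewrite !divr_gt0//; have := l_lt0; lra.
exists f; split => //.
have := iter_diff_le shiftedB shifted_sym shifted_ge0 k f.
have := iter_lower shiftedB shifted_sym shifted_ge0 k f.
rewrite /= f1 (ip_shifted f f) f1 mulr1 opprB addrCA subrr addr0.
set b := M^-1 * (_ - _) => a1 a2.
have -> : ip (K (iter k P f)) f =
    l * ip (iter k P f) f + M * (ip (iter k P f) f - ip (P (iter k P f)) f).
  have /(congr1 (ip^~ f)) := shiftedE (iter k P f).
  by rewrite !(ipDl, ipNl, ipZl); lra.
have bE : M * b <= - l / 2 / (k%:R * - l / M + 1).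
  by rewrite /b mulrA divff ?gt_eqF// mul1r; lra.
have : M * b * (k%:R * - l / M + 1) <= - l / 2.
  by rewrite -ler_pdivlMr.
have -> : M * b * (k%:R * - l / M + 1) = k%:R * b * - l + M * b.
  by field; rewrite gt_eqF.
have : M * (ip (iter k P f) f - ip (P (iter k P f)) f) <= M * b by rewrite ler_pM2l.
have : l * ip (iter k P f) f <= l * (1 - k%:R * b) by rewrite ler_nM2l.
lra.
Qed.

Hypothesis no_eigenvector :
  forall u, ip (K u - l *: u) (K u - l *: u) = 0 -> ip u u = 0.

(** The limit u is that of K P^k h, given by [Kcvg]. Since (K - l) P^k h = M (P^k h - P^(k+1) h)
    tends to 0, l P^k h also tends to u. Hence K u = l u, u is null, and dividing by l != 0
    concludes. *)
Lemma shifted_iter_cvg0 h e : 0 < e ->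
  \forall k \near \oo, ip (iter k P h) (iter k P h) <= e.
Proof.
pose g k := iter k P h.
have gC d : 0 < d -> \forall N \near \oo, forall i j, (N <= i)%N -> (N <= j)%N ->
    ip (g i - g j) (g i - g j) <= d.
  exact: (iter_cauchy shiftedB shifted_sym shifted_ge0 shifted_le1).
have [u Ku] := Kcvg gC.
have Kg d : 0 < d -> \forall k \near \oo,
    ip (K (g k) - l *: g k) (K (g k) - l *: g k) <= d.
  move=> d0; have /gC[N _ NP] : 0 < d / M ^+ 2 by rewrite divr_gt0// exprn_gt0.
  exists N => // k /= Nk.
  rewrite shiftedE ipZl ipZr mulrA -expr2 -ler_pdivlMl ?exprn_gt0//.
  rewrite mulrC -[P (g k)]/(g k.+1).
  by have := NP N (leqnn _) k k.+1; apply => //; exact: leqW.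
have ug d : 0 < d -> \forall k \near \oo, ip (u - l *: g k) (u - l *: g k) <= d.
  move=> d0; have d4 : 0 < d / 4 by rewrite divr_gt0.
  near=> k.
  have -> : u - l *: g k = (u - K (g k)) + (K (g k) - l *: g k).
    by rewrite addrA subrK.
  apply: le_trans (ip_sqrD_le _ _) _.
  have : ip (u - K (g k)) (u - K (g k)) <= d / 4 by near: k; exact: Ku.
  have : ip (K (g k) - l *: g k) (K (g k) - l *: g k) <= d / 4 by near: k; exact: Kg.
  lra.
have u0 : ip u u = 0.
  apply: no_eigenvector; apply/eqP; rewrite eq_le ip_ge0 andbT.
  apply/ler_addgt0Pl => d d0; rewrite addr0.
  (* K u - l u is the sum of K (u - l P^k h) and - l (u - K P^k h). If both differences have square
     at most D, its square is at most 2 (C + l^2) D <= d. *)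
  pose D := d / (2 * (C + l ^+ 2 + 1)).
  have CC : 0 < C + l ^+ 2 + 1 by rewrite ltr_wpDl// addr_ge0// sqr_ge0.
  have D0 : 0 < D by rewrite divr_gt0// mulr_gt0.
  have [k [k1 k2]] : exists k, ip (u - l *: g k) (u - l *: g k) <= D /\
      ip (u - K (g k)) (u - K (g k)) <= D.
    have [N1 _ H1] := ug _ D0; have [N2 _ H2] := Ku _ D0.
    by exists (maxn N1 N2); split; [apply: H1|apply: H2] => /=;
      rewrite ?leq_maxl ?leq_maxr.
  have -> : K u - l *: u = K (u - l *: g k) + (- l) *: (u - K (g k)).
    rewrite (raddfB K)/= (linearZ_LR K)/= scalerBr !scaleNr opprK.
    by rewrite addrACA addNr addr0.
  apply: le_trans (ip_sqrD_le _ _) _; rewrite (ipZl (- l)) ipZr.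
  have := Kbnd (u - l *: g k).
  have : C * ip (u - l *: g k) (u - l *: g k) <= C * D by rewrite ler_wpM2l.
  have : l ^+ 2 * ip (u - K (g k)) (u - K (g k)) <= l ^+ 2 * D.
    by rewrite ler_wpM2l ?sqr_ge0.
  have -> : d = 2 * (C + l ^+ 2 + 1) * D by rewrite /D; field; rewrite gt_eqF.
  rewrite mulrA mulrNN -expr2; lra.
move=> e0.
have l2 : 0 < l ^+ 2 by rewrite exprn_even_gt0//= lt_eqF.
(* As u is null, l^2 ||P^k h||^2 <= 2 ||l P^k h - u||^2. *)
have : 0 < l ^+ 2 * e / 2 by rewrite divr_gt0// mulr_gt0.
move=> /ug; apply: filterS => k kP.
rewrite -(ler_pM2l l2) -/(g k).
have := ip_sqrD_le (l *: g k - u) u; rewrite subrK ipZl ipZr mulrA -expr2 u0.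
by rewrite -(opprB u) ipNl ipNr; lra.
Unshelve. all: by end_near.
Qed.

End symmetric.
End semi_inner_product.

(** * Carleman operators on L^2 *)

Section square_integrable.
Context d (T : measurableType d) (R : realType) (mu : {measure set T -> \bar R}).
Local Notation V := (LfunType mu (lee1n 2)).
Implicit Types f g : V.

Lemma sqr_integrable_Lfun2 (f : T -> R) : measurable_fun setT f ->
  (\int[mu]_x (f x ^+ 2)%:E < +oo)%E -> f \in Lfun mu 2%:E.
Proof.
move=> mf fi; rewrite inE; apply/andP; split; rewrite inE//= /finite_norm unlock/=.
apply: poweR_lty; apply: le_lt_trans fi; rewrite le_eqVlt; apply/orP; left.
apply/eqP/eq_integral => x _.
by rewrite /= powR_mulrn// real_normK ?num_real.
Qed.

Definition dot f g : R := \int[mu]_x (f x * g x).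

Lemma dot_integrable f g : mu.-integrable setT (EFin \o (fun x => f x * g x)).
Proof. exact/Lfun1_integrable/Lfun2_mul_Lfun1/LfunP/LfunP. Qed.

Lemma dot_fin f g : ((dot f g)%:E = \int[mu]_x (f x * g x)%:E)%E.
Proof.
by rewrite /dot /Rintegral fineK// integrable_fin_num//; exact: dot_integrable.
Qed.

Lemma dot_semi_inner : semi_inner_product dot.
Proof.
split=> [f g|f g h|a f g|f].
- by apply: eq_Rintegral => x _; rewrite mulrC.
- rewrite -RintegralD//; try exact: dot_integrable.
  by apply: eq_Rintegral => x _; rewrite -mulrDl.
- rewrite -RintegralZl//; last exact: dot_integrable.
  by apply: eq_Rintegral => x _; rewrite mulrA.
- by apply: Rintegral_ge0 => x _; rewrite -expr2 sqr_ge0.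
Qed.

Lemma dot_eq0 f : dot f f = 0 <-> {ae mu, forall x, f x = 0}.
Proof.
split => [f0|f0].
  have : ae_eq mu setT (fun x => (f x * f x)%:E) (cst 0%E).
    apply/ae_eq_integral_abs => //.
      by apply/measurable_EFinP; exact: measurable_funM.
    under eq_integral do rewrite gee0_abs ?lee_fin -?expr2 ?sqr_ge0//.
    by under eq_integral do rewrite expr2; rewrite -dot_fin f0.
  by apply: filterS => x /(_ I)[/eqP]; rewrite -expr2 sqrf_eq0 => /eqP.
rewrite /dot /Rintegral (ae_eq_integral (cst 0%E))//.
- by rewrite integral0.
- by apply/measurable_EFinP; exact: measurable_funM.
- by apply: filterS f0 => x /= -> _; rewrite mul0r.
Qed.

Section carleman.
Context (r : T -> V).
Hypothesis r_measurable : forall f, measurable_fun setT (fun x => dot (r x) f).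
Hypothesis r_integrable : mu.-integrable setT (fun x => (dot (r x) (r x))%:E).

Let dP := dot_semi_inner.
(** The squared Hilbert-Schmidt norm of the kernel with rows [r x]. *)
Let C := \int[mu]_x dot (r x) (r x).

Let C_ge0 : 0 <= C.
Proof. by apply: Rintegral_ge0 => x _; exact: ip_ge0. Qed.

Lemma dominated_Lfun2 (u : T -> R) (b : R) : measurable_fun setT u ->
  (forall x, u x ^+ 2 <= b * dot (r x) (r x)) -> u \in Lfun mu 2%:E.
Proof.
move=> mu_ ub; apply: sqr_integrable_Lfun2 => //.
have /integrableP[_] := integrableZl measurableT b r_integrable.
apply: le_lt_trans; apply: ge0_le_integral => //.
- by move=> x _; rewrite lee_fin sqr_ge0.
- by apply/measurable_EFinP; exact: measurable_funX.
- apply: measurableT_comp => //; apply: emeasurable_funM => //.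
  by case/integrableP: r_integrable.
- move=> x _; rewrite -EFinM abse_EFin lee_fin.
  by apply: le_trans (ub x) _; exact: ler_norm.
Qed.

Lemma dominated_dot (u : V) (b : R) :
  (forall x, u x ^+ 2 <= b * dot (r x) (r x)) -> dot u u <= b * C.
Proof.
move=> ub; rewrite /C -RintegralZl//.
apply: le_Rintegral => //.
- exact: dot_integrable.
- exact: (integrableZl measurableT b r_integrable).
- by move=> x _; rewrite -expr2.
Qed.

Lemma carleman_Lfun2 f : (fun x => dot (r x) f) \in Lfun mu 2%:E.
Proof.
apply: (@dominated_Lfun2 _ (dot f f)) => // x.
by rewrite mulrC; exact: ip_cauchy_schwarz.
Qed.

(** The value is prescribed at every x, not just almost everywhere, so evaluation at x is a bounded
    functional of f. *)
Definition carleman f : V := Lfun_Sub (lee1n 2) (carleman_Lfun2 f).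

Lemma carlemanE f x : carleman f x = dot (r x) f. Proof. by []. Qed.

Let carleman_linear : linear carleman.
Proof.
move=> a f g; apply/LfuneqP => x.
by rewrite carlemanE (ipDr dP) (ipZr dP).
Qed.

HB.instance Definition _ := GRing.isLinear.Build R V V *:%R carleman carleman_linear.

Lemma carleman_bounded f : dot (carleman f) (carleman f) <= C * dot f f.
Proof.
rewrite mulrC; apply: dominated_dot => x; rewrite carlemanE mulrC.
exact: ip_cauchy_schwarz.
Qed.

(* Since evaluation at [x] of [carleman f] is continuous in [f], the image of a
   Cauchy sequence converges pointwise: completeness of L^2 is not needed. *)
Lemma carleman_cauchy_cvg (g : nat -> V) :
  (forall e, 0 < e -> \forall N \near \oo, forall i j, (N <= i)%N -> (N <= j)%N ->
    dot (g i - g j) (g i - g j) <= e) ->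
  exists u : V, forall e, 0 < e ->
    \forall k \near \oo, dot (u - carleman (g k)) (u - carleman (g k)) <= e.
Proof.
move=> gC.
pose v k x := dot (r x) (g k).
have vC e N i j x : (forall i j, (N <= i)%N -> (N <= j)%N ->
    dot (g i - g j) (g i - g j) <= e) -> (N <= i)%N -> (N <= j)%N ->
    (v i x - v j x) ^+ 2 <= e * dot (r x) (r x).
  move=> H Ni Nj; rewrite /v -(ipNr dP) -(ipDr dP).
  apply: le_trans (ip_cauchy_schwarz dP _ _) _.
  by rewrite mulrC ler_wpM2r ?(ip_ge0 dP)// H.
have vcvg x : cvgn (v ^~ x).
  apply/cauchy_cvgP/cauchy_exP => e e0.
  (* Makes b ||r x||^2 < e^2; the added 1 covers a null row. *)
  pose b := e ^+ 2 / 2 / (dot (r x) (r x) + 1).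
  have r1 : 0 < dot (r x) (r x) + 1 by rewrite ltr_wpDl// (ip_ge0 dP).
  have b0 : 0 < b by rewrite !divr_gt0// exprn_gt0.
  have [N _ HN] := gC _ b0.
  exists (v N x); exists N => // k /= Nk; rewrite /ball/=.
  rewrite -(@ltr_pXn2r _ 2)// ?nnegrE ?(ltW e0)// real_normK ?num_real//.
  apply: (le_lt_trans (vC b N N k x (HN N (leqnn _)) (leqnn _) Nk)).
  have : b * (dot (r x) (r x) + 1) < e ^+ 2.
    by rewrite /b mulfVK ?gt_eqF// gtr_pMr ?exprn_gt0// invf_lt1// ltr1n.
  by have := ltW b0; lra.
pose u x := limn (v ^~ x).
have um : measurable_fun setT u.
  apply: (measurable_fun_cvg (h := v)) => [k|x _]; first exact: r_measurable.
  exact: vcvg.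
have uv e N k x : (forall i j, (N <= i)%N -> (N <= j)%N ->
    dot (g i - g j) (g i - g j) <= e) -> (N <= k)%N ->
    (u x - v k x) ^+ 2 <= e * dot (r x) (r x).
  move=> H Nk.
  have : (fun i => (v i x - v k x) ^+ 2) @ \oo --> (u x - v k x) ^+ 2.
    have /cvgB/(_ (cvg_cst (v k x))) h := vcvg x.
    rewrite expr2; under eq_fun do rewrite expr2.
    by apply: cvgM; exact: h.
  move=> vv; rewrite -(cvg_lim _ vv)//; apply: limr_le.
    by apply/cvg_ex; eexists; exact: vv.
  by exists N => // i /= Ni; exact: vC H Ni Nk.
have [N _ HN] := gC 1 ltr01.
have uL : (fun x => u x - v N x) \in Lfun mu 2%:E.
  apply: (@dominated_Lfun2 _ 1).
    by apply: measurable_funB => //; exact: r_measurable.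
  by move=> x; apply: (uv 1 N) => //; exact: (HN N (leqnn _)).
(* [w] has the values of [u]. It lies in L^2 because u - v_N is dominated by a multiple of ||r x||
   and v_N is [carleman (g N)]. *)
pose w : V := Lfun_Sub (lee1n 2) uL + carleman (g N).
exists w => e e0.
have : 0 < e / (C + 1) by rewrite divr_gt0// ltr_wpDl.
move=> /gC; apply: filterS => M HM.
have : dot (w - carleman (g M)) (w - carleman (g M)) <= e / (C + 1) * C.
  apply: dominated_dot => x.
  have -> : (w - carleman (g M)) x = u x - v N x + v N x - v M x by [].
  rewrite subrK.
  by apply: (uv _ M) => //; exact: HM.
move=> /le_trans; apply.
by rewrite -mulrA ger_pMr// ler_pdivrMl ?mulr1 ?ltr_wpDl// lerDl.
Qed.

Hypothesis carleman_sym : forall f g, dot (carleman f) g = dot f (carleman g).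

Lemma carleman_ge0 :
  (forall (l : R) (u : V), l < 0 -> {ae mu, forall x, carleman u x = l * u x} ->
    {ae mu, forall x, u x = 0}) ->
  forall f, 0 <= dot (carleman f) f.
Proof.
move=> noeig z; rewrite real_leNgt ?num_real//; apply/negP => z_lt0.
have ip0 f : dot f f = 0 -> dot (carleman f) f = 0.
  move=> f0; have := ip_cauchy_schwarz dP (carleman f) f.
  by rewrite f0 mulr0 => h; apply/eqP; rewrite -sqrf_eq0 eq_le h sqr_ge0.
have dot_gt0 f : dot (carleman f) f != 0 -> 0 < dot f f.
  by rewrite lt_neqAle (ip_ge0 dP) andbT [0 == _]eq_sym; apply: contra_neq => /ip0.
have scale f : 0 < dot f f -> exists g, dot g g = 1 /\
    dot (carleman g) g = dot (carleman f) f / dot f f.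
  move=> f0; have s0 : Num.sqrt (dot f f) != 0 by rewrite gt_eqF// sqrtr_gt0.
  have sE : dot f f = Num.sqrt (dot f f) ^+ 2 by rewrite sqr_sqrtr// ltW.
  move: (Num.sqrt _) s0 sE => s s0 sE; exists (s^-1 *: f).
  rewrite (linearZ_LR carleman)/= !(ipZl dP, ipZr dP) sE.
  by split; field.
pose S := [set a | exists f, dot f f = 1 /\ a = dot (carleman f) f].
(* On unit vectors <K f, f>^2 <= C < (C + 1)^2. *)
have lbS : lbound S (- (C + 1)).
  move=> _ [f [f1 ->]].
  have := ip_cauchy_schwarz dP (carleman f) f; have := carleman_bounded f.
  rewrite f1 !mulr1 => h1 h2; rewrite lerNl real_leNgt ?num_real//; apply/negP => h.
  by have := C_ge0; nra.
have infS : has_inf S.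
  have [g [g1 gE]] := scale z (dot_gt0 z (negbT (lt_eqF z_lt0))).
  by split; [exists (dot (carleman g) g); exists g|exists (- (C + 1))].
pose l := inf S.
have l_le f : l * dot f f <= dot (carleman f) f.
  have := ip_ge0 dP f; rewrite le_eqVlt => /orP[/eqP/esym f0|f0].
    by rewrite f0 mulr0 ip0.
  have [g [g1 gE]] := scale f f0.
  rewrite -ler_pdivlMr// -gE; apply: ge_inf; first by case: infS.
  by exists g.
have l_lt0 : l < 0.
  rewrite -(pmulr_llt0 _ (dot_gt0 z (negbT (lt_eqF z_lt0)))).
  exact: le_lt_trans (l_le z) z_lt0.
have l_inf e : 0 < e -> exists f, dot f f = 1 /\ dot (carleman f) f <= l + e.
  move=> e0; have [_ [f [f1 ->]] h] := inf_adherent e0 infS.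
  by exists f; split=> //; exact: ltW.
have noeig_dot u : dot (carleman u - l *: u) (carleman u - l *: u) = 0 ->
    dot u u = 0.
  move=> /dot_eq0 h; apply/dot_eq0/(noeig l u l_lt0).
  by apply: filterS h => x /= /eqP; rewrite subr_eq0 => /eqP.
pose P := shifted carleman C l.
have Psym := shifted_sym dP C carleman_sym l.
(* These vectors vary with k, so the convergence of P^k h to 0 for a fixed h says nothing about P^k
   f_k; it will be applied to the rows h = r x instead. *)
pose f k := projT1 (cid (shifted_near_min dP carleman_sym C_ge0 carleman_bounded
  l_lt0 l_inf k)).
have [f1 fl] : (forall k, dot (f k) (f k) = 1) /\
    (forall k, dot (carleman (iter k P (f k))) (f k) <= l / 2).
  by split => k; rewrite /f; case: cid => ? [].
pose u k := carleman (iter k P (f k)).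
(* [P] is symmetric, hence [u k x] = <P^k (r x), f k>. *)
have uP k x : u k x ^+ 2 <= dot (iter k P (r x)) (iter k P (r x)).
  rewrite /u carlemanE -[X in dot X _]/(iter 0 P (r x)).
  rewrite (ip_iter Psym) add0n.
  by apply: le_trans (ip_cauchy_schwarz dP _ _) _; rewrite f1 mulr1.
have Pcvg h e : 0 < e -> \forall k \near \oo, dot (iter k P h) (iter k P h) <= e.
  exact: (shifted_iter_cvg0 dP carleman_sym C_ge0 carleman_bounded
    carleman_cauchy_cvg l_lt0 l_le noeig_dot).
(* ||P^k h||^2 = <P^(2k) h, h> is at most <h, h> by monotonicity; hence ||r x||^2 dominates every
   u_k(x)^2. *)
have P_le k h : dot (iter k P h) (iter k P h) <= dot h h.
  rewrite (ip_iter Psym); elim: (k + k)%N => //= n; apply: le_trans.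
  apply: (iter_nincr dP (shiftedB carleman C l) Psym).
  - exact: (shifted_ge0 dP C_ge0 carleman_bounded l_lt0).
  - exact: (shifted_le1 dP C_ge0 l_lt0 l_le).
have u_cvg0 : (\int[mu]_x (u k x ^+ 2)%:E)%E @[k --> \oo] --> 0%E.
  rewrite -(integral0 mu setT).
  apply: (dominated_cvg _ _ _ _ r_integrable) => //.
  - by move=> k; apply/measurable_EFinP; exact: measurable_funX.
  - move=> x _; apply: cvg_EFin; first by apply: nearW.
    apply/cvgrPdist_le => e e0; have := Pcvg (r x) e e0.
    apply: filterS => k kP; rewrite /= sub0r normrN ger0_norm ?sqr_ge0//.
    exact: le_trans (uP k x) kP.
  - move=> k x _; rewrite /= lee_fin ger0_norm ?sqr_ge0//.
    exact: le_trans (uP k x) (P_le k _).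
(* Pairing with the unit vector f_k shows ||u_k|| >= - l / 2, which contradicts [u_cvg0]. *)
have u_ge k : l ^+ 2 / 4 <= dot (u k) (u k).
  have := ip_cauchy_schwarz dP (u k) (f k); rewrite f1 mulr1; apply: le_trans.
  have := fl k; rewrite -/(u k) => ukl.
  have : (- l / 2) ^+ 2 <= (- dot (u k) (f k)) ^+ 2.
    by rewrite ler_pXn2r// ?nnegrE; have := l_lt0; lra.
  by rewrite sqrrN expr_div_n sqrrN; lra.
have l4 : 0 < l ^+ 2 / 4 by rewrite divr_gt0// exprn_even_gt0//= lt_eqF.
move/fine_cvgP : u_cvg0 => [_ /cvgrPdist_lt/(_ _ l4)[k _ /(_ k (leqnn k))]].
rewrite /= sub0r normrN ger0_norm; last first.
  by rewrite fine_ge0// integral_ge0// => x _; rewrite lee_fin sqr_ge0.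
by apply/negP; rewrite -leNgt; exact: u_ge.
Qed.

End carleman.
End square_integrable.

(** * Hilbert-Schmidt kernels *)

Lemma ae_eq_Rintegral d (T : measurableType d) (R : realType)
    (mu : {measure set T -> \bar R}) (f g : T -> R) :
  measurable_fun setT f -> measurable_fun setT g ->
  {ae mu, forall x, f x = g x} -> \int[mu]_x f x = \int[mu]_x g x.
Proof.
move=> mf mg fg; congr fine; apply: ae_eq_integral => //; try exact/measurable_EFinP.
by apply: filterS fg => x /= ->.
Qed.

(** Tonelli's theorem applies to the positive and negative parts separately; [fine] gives the value
    0 wherever the integral of the section is infinite. *)
Lemma measurable_Rintegral_section d1 d2 (T1 : measurableType d1)
    (T2 : measurableType d2) (R : realType)
    (m2 : {sigma_finite_measure set T2 -> \bar R}) (f : T1 * T2 -> R) :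
  measurable_fun setT f -> measurable_fun setT (fun x => \int[m2]_y f (x, y)).
Proof.
move=> mf; apply: measurableT_comp => //.
under eq_fun do rewrite integralE.
apply: emeasurable_funB.
- under eq_fun do under eq_integral do rewrite funeposE -(funeposE (EFin \o f)).
  refine (measurable_fun_fubini_tonelli_F _ _ _) => //.
  by apply: measurable_funepos; exact/measurable_EFinP.
- under eq_fun do under eq_integral do rewrite funenegE -(funenegE (EFin \o f)).
  refine (measurable_fun_fubini_tonelli_F _ _ _) => //.
  by apply: measurable_funeneg; exact/measurable_EFinP.
Qed.

Section hilbert_schmidt.
Context d (T : measurableType d) (R : realType).
Context (mu : {sigma_finite_measure set T -> \bar R}) (k : T * T -> R).
Hypothesis k_measurable : measurable_fun setT k.
Hypothesis k_sqr : (\int[mu]_y \int[mu]_x (k (x, y) ^+ 2)%:E < +oo)%E.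
Local Notation V := (LfunType mu (lee1n 2)).
Implicit Types f g : V.

Local Notation N x := (\int[mu]_y (k (x, y) ^+ 2)%:E)%E.
Local Notation K f x := (\int[mu]_y (k (x, y) * f y)).

Let mk2 : measurable_fun setT (fun p => (k p ^+ 2)%:E).
Proof. by apply/measurable_EFinP; exact: measurable_funX. Qed.

Let N_ge0 x : (0 <= N x)%E.
Proof. by apply: integral_ge0 => y _; rewrite lee_fin sqr_ge0. Qed.

Let N_measurable : measurable_fun setT (fun x => N x).
Proof.
apply: (measurable_fun_fubini_tonelli_F (fun p => (k p ^+ 2)%:E)) => // p.
by rewrite lee_fin sqr_ge0.
Qed.

Let N_integrable : mu.-integrable setT (fun x => N x).
Proof.
apply/integrableP; split => //.
under eq_integral do rewrite gee0_abs//.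
(* [k_sqr] integrates over x first and [N] over y first; Tonelli exchanges the order. *)
rewrite (fubini_tonelli (fun p => (k p ^+ 2)%:E))// => p.
by rewrite lee_fin sqr_ge0.
Qed.

Let row_measurable x : measurable_fun setT (fun y => k (x, y)).
Proof. exact: measurableT_comp. Qed.

(* Rows outside L^2 form a null set; they are replaced by 0. *)
Definition kernel_row (x : T) : V :=
  match pselect (N x < +oo)%E with
  | left h => Lfun_Sub (lee1n 2) (sqr_integrable_Lfun2 (row_measurable x) h)
  | right _ => 0
  end.

Let D := [set x | (N x < +oo)%E].

Let D_measurable : measurable D.
Proof. by rewrite -[D]setTI; exact: emeasurable_fun_infty_o. Qed.

Let D_ae : {ae mu, forall x, D x}.
Proof.
have := integrable_ae measurableT N_integrable; apply: filterS => x /(_ I).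
by rewrite ge0_fin_numE.
Qed.

Lemma kernel_rowE x y : D x -> kernel_row x y = k (x, y).
Proof. by rewrite /kernel_row => Dx; case: pselect. Qed.

Lemma dot_rowE f : (fun x => dot (kernel_row x) f) = (fun x => K f x) \_ D.
Proof.
apply/funext => x; rewrite patchE; case: ifPn => [/set_mem Dx|/negP Dx].
  by apply: eq_Rintegral => y _; rewrite kernel_rowE.
rewrite /kernel_row; case: pselect => [h|_].
  by exfalso; apply: Dx; exact: mem_set.
have := ipZl (@dot_semi_inner _ _ _ mu) 0 0 f.
by rewrite scale0r mul0r.
Qed.

Let kf_measurable f : measurable_fun setT (fun p : T * T => k p * f p.2).
Proof. by apply: measurable_funM => //; apply: measurableT_comp. Qed.

Let K_measurable f : measurable_fun setT (fun x => K f x).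
Proof. exact: measurable_Rintegral_section (kf_measurable f). Qed.

Lemma dot_row_measurable f : measurable_fun setT (fun x => dot (kernel_row x) f).
Proof.
rewrite dot_rowE; apply/(measurable_restrictT _ D_measurable).
exact: measurable_funTS.
Qed.

Lemma dot_row_integrable :
  mu.-integrable setT (fun x => (dot (kernel_row x) (kernel_row x))%:E).
Proof.
have E x : ((dot (kernel_row x) (kernel_row x))%:E = ((fun x => N x) \_ D) x)%E.
  rewrite dot_fin patchE; case: ifPn => [/set_mem Dx|/negP Dx].
    by apply: eq_integral => y _; rewrite kernel_rowE// expr2.
  rewrite /kernel_row; case: pselect => [h|_].
    by exfalso; apply: Dx; exact: mem_set.
  by under eq_integral do rewrite mul0r; rewrite integral0.
under eq_fun do rewrite E.
apply/(integrable_mkcond _ D_measurable); exact: integrableS N_integrable.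
Qed.

Local Notation Kc := (carleman dot_row_measurable dot_row_integrable).

Let KcE f : {ae mu, forall x, Kc f x = K f x}.
Proof.
apply: filterS D_ae => x Dx.
have /(congr1 (fun h => h x)) := dot_rowE f.
by rewrite carlemanE patchE mem_set.
Qed.

Hypothesis K_sym : forall f g,
  \int[mu]_x (K f x * g x) = \int[mu]_x (f x * K g x).

Hypothesis K_eigen : forall (l : R) f, l < 0 ->
  {ae mu, forall x, K f x = l * f x} -> {ae mu, forall x, f x = 0}.

(** Replacing bad rows by 0 changes K f only on a null set, so symmetry and the absence of negative
    eigenvalues pass to [Kc], and [carleman_ge0] applies. The rest is Fubini: <K f, f> integrates
    over y first, the conclusion over x first. *)
Lemma hilbert_schmidt_ge0 f :
  (0 <= \int[mu]_y \int[mu]_x (f x * k (x, y) * f y)%:E)%E.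
Proof.
have Kc_sym g h : dot (Kc g) h = dot g (Kc h).
  rewrite /dot; transitivity (\int[mu]_x (K g x * h x)).
    apply: ae_eq_Rintegral; try exact: measurable_funM.
    by apply: filterS (KcE g) => x /= ->.
  rewrite K_sym; apply: ae_eq_Rintegral; try exact: measurable_funM.
  by apply: filterS (KcE h) => x /= ->.
have : 0 <= dot (Kc f) f.
  apply: (carleman_ge0 Kc_sym) => l u l0 lu; apply: K_eigen l0 _.
  by apply: filterS2 lu (KcE u) => x /= -> ->.
rewrite -lee_fin dot_fin => /le_trans; apply.
pose F (p : T * T) := f p.1 * k p * f p.2.
have mF : measurable_fun setT F.
  by apply: measurable_funM; [apply: measurable_funM => //|];
    exact: measurableT_comp.
(* [H] dominates |[F]| by |a b| <= a^2 + b^2 with a = k(x, y) and b = f(x) f(y). Its terms have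
   finite integrals, by [k_sqr] and <f, f>^2. *)
pose H (p : T * T) := ((k p ^+ 2)%:E + ((f p.1 ^+ 2)%:E * (f p.2 ^+ 2)%:E))%E.
have mf2 : measurable_fun setT (fun x => (f x ^+ 2)%:E).
  by apply/measurable_EFinP; exact: measurable_funX.
have f2 : (\int[mu]_x (f x ^+ 2)%:E = (dot f f)%:E)%E.
  by rewrite dot_fin; apply: eq_integral => x _; rewrite expr2.
have HI : (\int[mu]_x \int[mu]_y H (x, y) < +oo)%E.
  under eq_integral => x _.
    rewrite ge0_integralD//=; last 4 first.
    - by move=> y _; rewrite lee_fin sqr_ge0.
    - exact/measurable_EFinP/measurable_funX.
    - by move=> y _; rewrite mule_ge0// lee_fin sqr_ge0.
    - exact: emeasurable_funM.
    rewrite ge0_integralZl//; last 2 first.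
    - by move=> y _; rewrite lee_fin sqr_ge0.
    - by rewrite lee_fin sqr_ge0.
    rewrite f2.
    over.
  rewrite ge0_integralD//; last 2 first.
  - move=> x _; rewrite mule_ge0// lee_fin ?sqr_ge0//.
    exact: (ip_ge0 (@dot_semi_inner _ _ _ mu)).
  - exact: emeasurable_funM.
  rewrite ge0_integralZr//; last 2 first.
  - by move=> y _; rewrite lee_fin sqr_ge0.
  - by rewrite lee_fin (ip_ge0 (@dot_semi_inner _ _ _ mu)).
  rewrite f2 -EFinM lte_add_pinfty// ?ltry//.
  exact: integrable_lty.
have Fint : (mu \x mu)%E.-integrable setT (EFin \o F).
  have mH : measurable_fun setT H.
    apply: emeasurable_funD => //; apply: emeasurable_funM.
      exact: (measurableT_comp mf2).
    exact: (measurableT_comp mf2).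
  have H0 p : (0 <= H p)%E by rewrite adde_ge0// ?mule_ge0// lee_fin sqr_ge0.
  apply: (@le_integrable _ _ _ _ _ measurableT _ H).
  - exact/measurable_EFinP.
  - move=> p _; rewrite (gee0_abs (H0 p)) /H /F -EFinM -EFinD abse_EFin lee_fin.
    rewrite ler_norml.
    have := sqr_ge0 (k p + f p.1 * f p.2); have := sqr_ge0 (k p - f p.1 * f p.2).
    have := sqr_ge0 (k p); have := sqr_ge0 (f p.1 * f p.2).
    by move=> *; apply/andP; split; nra.
  - apply/(integrable12ltyP _ _ mH).
    by under eq_integral do under eq_integral do rewrite gee0_abs//.
rewrite -(Fubini Fint) le_eqVlt; apply/orP; left; apply/eqP.
apply: ae_eq_integral => //.
- by apply/measurable_EFinP; exact: measurable_funM.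
- by case/integrableP: (integrable_fubini_F Fint).
apply: filterS D_ae => x Dx _.
rewrite carlemanE /fubini_F /F/= mulrC EFinM dot_fin -integralZl//; last first.
  exact: dot_integrable.
by apply: eq_integral => y _; rewrite /= -EFinM kernel_rowE// mulrA.
Qed.

End hilbert_schmidt.

(** * Green's function *)

Lemma patch_setXE T (R : realType) (U : set T) (F : T -> T -> R) x y :
  ((fun p => F p.1 p.2) \_ (U `*` U)) (x, y) =
  if x \in U then if y \in U then F x y else 0 else 0.
Proof.
by rewrite patchE in_setX/=; case: (x \in U); case: (y \in U).
Qed.

Lemma iterated_integral_mkcond d (T : measurableType d) (R : realType)
    (mu : {measure set T -> \bar R}) (U : set T) (F : T -> T -> R) :
  (\int[mu]_(y in U) \int[mu]_(x in U) (F x y)%:E =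
   \int[mu]_y \int[mu]_x (((fun p => F p.1 p.2) \_ (U `*` U)) (x, y))%:E)%E.
Proof.
rewrite integral_mkcond; apply: eq_integral => y _; rewrite patchE.
case: ifPn => Uy.
  rewrite integral_mkcond; apply: eq_integral => x _.
  by rewrite patch_setXE Uy patchE; case: ifPn.
transitivity (\int[mu]_x (cst 0 x : \bar R))%E; first by rewrite integral0.
by apply: eq_integral => x _; rewrite patch_setXE (negbTE Uy) if_same.
Qed.

Section green.
Context (R : realType) (n : nat) (c : collection R n).
Hypotheses (hc : admissible c) (hA : positive_operator c).
Context (G : 'rV[R]_n -> 'rV[R]_n -> R).
Hypothesis hG : green_function c G.

Local Notation U := (region c).
(** Extension by 0 off U x U turns integrals over U into integrals over the whole space, the setting
    of [hilbert_schmidt_ge0]. *)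
Local Notation k := ((fun p => G p.1 p.2) \_ (U `*` U)).
Local Notation V := (LfunType (leb n) (lee1n 2)).
Local Notation K f x := (\int[leb n]_y (k (x, y) * f y)).

Let U_measurable : measurable U.
Proof. by apply: open_measurable_rV; exact: region_open. Qed.

Let k_measurable : measurable_fun setT k.
Proof.
have [mG _ _] := hG.
exact/(measurable_restrictT _ (measurableX U_measurable U_measurable)).
Qed.

Let k_sqr : (\int[leb n]_y \int[leb n]_x (k (x, y) ^+ 2)%:E < +oo)%E.
Proof.
have [_ + _] := hG; rewrite (iterated_integral_mkcond _ U).
apply: le_lt_trans; rewrite le_eqVlt; apply/orP; left; apply/eqP.
apply: eq_integral => y _; apply: eq_integral => x _.
rewrite (patch_setXE _ (fun x y => G x y ^+ 2)) (patch_setXE _ G).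
by case: (x \in U); case: (y \in U); rewrite ?expr0n.
Qed.

Lemma Lfun2_L2 (A : set 'rV[R]_n) (f : V) : measurable A -> L2 A f.
Proof.
move=> mA; split; first exact: measurable_funTS.
have /integrable_lty := Lfun2_integrable_sqr (LfunP f).
move=> /(_ measurableT); apply: le_lt_trans.
apply: ge0_subset_integral => //.
- by apply/measurable_EFinP; exact: measurable_funX.
- by move=> x _; rewrite lee_fin sqr_ge0.
Qed.

Lemma L2_Lfun2 (A : set 'rV[R]_n) (f : 'rV[R]_n -> R) :
  measurable A -> L2 A f -> f \_ A \in Lfun (leb n) 2%:E.
Proof.
move=> mA [mf fi]; apply: sqr_integrable_Lfun2.
  exact/(measurable_restrictT _ mA).
move: fi; rewrite (integral_mkcond A); apply: le_lt_trans.
rewrite le_eqVlt; apply/orP; left; apply/eqP; apply: eq_integral => x _.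
by rewrite !patchE; case: ifPn; rewrite ?expr0n.
Qed.

(** Surjectivity of A provides u with A u = f, and the defining property of the Green's function
    identifies u with the integral on U; off U both sides are 0. *)
Lemma green_operator_ex (f : V) : exists u, green_operator c f u /\
  {ae leb n, forall x, K f x = (u \_ U) x}.
Proof.
have fL : L2 U f by exact: Lfun2_L2.
have [u [Du Au]] := operator_onto hc fL.
exists u; have Guf : green_operator c f u by split.
split => //; have [_ _ /(_ f u Guf)] := hG.
apply: filterS => x ux; rewrite patchE; case: ifPn => [/set_mem Ux|Ux].
  rewrite (ux Ux) [RHS]Rintegral_mkcond; apply: eq_Rintegral => y _.
  rewrite (patch_setXE _ G) (mem_set Ux) [RHS]patchE.
  by case: ifPn => //; rewrite mul0r.
transitivity (\int[leb n]_(y in [set: 'rV[R]_n]) (cst 0 y : R)); last first.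
  by rewrite /Rintegral integral0.
by apply: eq_Rintegral => y _; rewrite (patch_setXE _ G) (negbTE Ux) mul0r.
Qed.

Lemma green_L2 f u : green_operator c f u -> L2 U u.
Proof. by case=> _ [[w []]]. Qed.

(** For the pairs (f, u) and (g, v) in the graph of the Green's operator, self-adjointness gives <u,
    g> = <f, v>, where u and v are K f and K g on U. *)
Lemma green_sym (f g : V) :
  \int[leb n]_x (K f x * g x) = \int[leb n]_x (f x * K g x).
Proof.
have [u [Gu uE]] := green_operator_ex f; have [v [Gv vE]] := green_operator_ex g.
have mK (h : V) : measurable_fun setT (fun x => K h x).
  apply: (@measurable_Rintegral_section _ _ _ _ _ (leb n) (fun p => k p * h p.2)).
  by apply: measurable_funM => //; exact: measurableT_comp.
have mU w h : green_operator c h w -> measurable_fun setT (w \_ U).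
  by move=> /green_L2[+ _] => /measurable_restrictT; apply.
have := green_self_adjoint hc (Lfun2_L2 g U_measurable) (green_L2 Gv).
move=> /iffLR/(_ Gv f u Gu); rewrite /inner => uv.
transitivity (\int[leb n]_(x in U) (u x * g x)).
  rewrite (Rintegral_mkcond _ U); transitivity (\int[leb n]_x ((u \_ U) x * g x)).
    apply: ae_eq_Rintegral.
    - by apply: measurable_funM => //; exact: mK.
    - by apply: measurable_funM => //; exact: mU Gu.
    - by apply: filterS uE => x /= ->.
  by apply: eq_Rintegral => x _; rewrite !patchE; case: ifPn; rewrite ?mul0r.
rewrite uv (Rintegral_mkcond _ U).
transitivity (\int[leb n]_x (f x * (v \_ U) x)).
  by apply: eq_Rintegral => x _; rewrite !patchE; case: ifPn; rewrite ?mulr0.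
apply: ae_eq_Rintegral.
- by apply: measurable_funM => //; exact: mU Gv.
- by apply: measurable_funM => //; exact: mK.
- by apply: filterS vE => x /= ->.
Qed.

(** With u = K f = l f, the equation A u = f reads A u = u / l on U, so positivity of A forces u = 0
    when l < 0. *)
Lemma green_no_negative_eigenvalue (l : R) (f : V) : l < 0 ->
  {ae leb n, forall x, K f x = l * f x} -> {ae leb n, forall x, f x = 0}.
Proof.
move=> l0 lf; have [u [[fL Du [w [uw fw]]] uE]] := green_operator_ex f.
have l_neq0 : l != 0 by rewrite lt_eqF.
have ul : {ae leb n, forall x, (u \_ U) x = l * f x}.
  by apply: filterS2 lf uE => x /= -> ->.
have u0 : ae_eq_on U u (cst 0).
  apply: contrapT => u_neq0; have : 0 < l^-1.
    apply: hA; exists u; split=> //; exists w; split=> //.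
    apply: filterS2 fw ul => x /= fx + Ux.
    by rewrite patchE mem_set// => ->; rewrite mulKf// fx.
  by rewrite invr_gt0 lt_gtF.
(* Off U, l f = 0 holds because K f is extended by 0 there. *)
apply: filterS2 u0 ul => x /= u0; rewrite patchE; case: ifPn => [/set_mem/u0 ->|_].
  by move=> /esym/eqP; rewrite mulf_eq0 (negbTE l_neq0) => /eqP.
by move=> /esym/eqP; rewrite mulf_eq0 (negbTE l_neq0) => /eqP.
Qed.

Lemma green_ge0 (z : 'rV[R]_n -> R) : L2 U z ->
  (0 <= \int[leb n]_(xi in U) \int[leb n]_(x in U) (z x * G x xi * z xi)%:E)%E.
Proof.
move=> zL; rewrite (iterated_integral_mkcond _ U).
have := hilbert_schmidt_ge0 k_measurable k_sqr green_sym green_no_negative_eigenvalue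
  (Lfun_Sub (lee1n 2) (L2_Lfun2 U_measurable zL)).
congr (_ <= _)%E; apply: eq_integral => y _; apply: eq_integral => x _.
rewrite /= (patch_setXE _ (fun x y => z x * G x y * z y)) (patch_setXE _ G) !patchE.
by case: (x \in U); case: (y \in U); rewrite ?mulr0 ?mul0r.
Qed.

End green.

Unset Implicit Arguments.

Theorem theorem2p1 (R : realType) (n : nat) (hn : (0 < n)%N)
    (c : collection R n) (hc : admissible c) (hA : positive_operator c)
    (hm : (n < (op_order c).*2)%N)
    (G : 'rV[R]_n -> 'rV[R]_n -> R) (hG : green_function c G)
    (z : 'rV[R]_n -> R) (hz : L2 (region c) z) :
  (0 <= \int[leb n]_(xi in region c) \int[leb n]_(x in region c)
          (z x * G x xi * z xi)%:E)%E.
Proof. exact: green_ge0 hz. Qed.
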